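(* If $G$ is a nontrivial graph without isolated vertices, then $\mathrm{a}_1'(G)\le \sigma(G)$. In particular, $\mathrm{a}_1'(T)=\sigma(T)$ holds for every nontrivial tree $T$ (i.e. every tree with at least two vertices).
   Context: Graphs are finite, simple and undirected; nontrivial means having at least two vertices. For positive integers $a,b$, the $(a,b)$-biased Maker-Breaker domination game on a graph $G$ is played by Dominator and Staller, who move alternately; on each move Dominator selects $a$ unplayed vertices and Staller selects $b$ unplayed vertices (if fewer unplayed vertices remain than the player's bias, the player selects all remaining ones). Dominator wins if the vertices he selected during the game form a dominating set of $G$; otherwise Staller wins, equivalently, Staller wins iff she claims all vertices of the closed neighborhood of some vertex. In the S-game Staller moves first, and $\mathrm{a}'_\ell(G)$ is the minimum positive integer $a$ such that Dominator wins the $(a,\ell)$-biased S-game on $G$ under optimal play ($\infty$ if no such $a$ exists). For a positive integer $k$, a graph $G$ has a $k$-star partition if there is a partition $\{S_1,\dots,S_m\}$ of $V(G)$ such that each $S_i$ satisfies $|S_i|\ge 2$ and the induced subgraph $G[S_i]$ contains a spanning star of order at most $k+1$ (a star being a graph $K_{1,r}$ with $r\ge 1$, of order $r+1$). The star partition width $\sigma(G)$ is the smallest integer $k$ such that $G$ has a $k$-star partition. *)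

(* Defs.v *)
From mathcomp Require Import all_boot.
From mathcomp Require Import boolp.

Set Implicit Arguments.
Unset Strict Implicit.
Unset Printing Implicit Defensive.

(* Values in nat extended with infinity, the latter represented by None *)
Definition enat := option nat.

Definition enat_le (x y : enat) : bool :=
  match x, y with
  | _, None => true
  | None, Some _ => false
  | Some m, Some n => m <= n
  end.

Lemma exists_asbool (P : nat -> Prop) :
  (exists n, P n) -> exists n, `[< P n >].
Proof. by case=> n Pn; exists n; apply/asboolP. Qed.

(* The least n satisfying P, and infinity if there is none *)
Definition least (P : nat -> Prop) : enat :=
  match pselect (exists n, P n) with
  | left exP => Some (ex_minn (exists_asbool exP))
  | right _ => None
  end.

Record sgraph := SGraph {
  vertex :> finType;
  adj : rel vertex;
  adj_sym : symmetric adj;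
  adj_irrefl : irreflexive adj
}.

Definition no_isolated (G : sgraph) : Prop :=
  forall v : G, exists u : G, adj v u.

Definition connected (G : sgraph) : Prop :=
  0 < #|G| /\ forall u v : G, connect (@adj G) u v.

(* ucycle also accepts sequences of at most two vertices, which are not cycles
   of a simple graph *)
Definition acyclic (G : sgraph) : Prop :=
  forall c : seq G, 2 < size c -> ~ ucycle (@adj G) c.

Definition tree (G : sgraph) : Prop := connected G /\ acyclic G.

Section Game.
Variable G : sgraph.

Definition dominating (D : {set G}) : Prop :=
  forall v : G, exists2 u : G, u \in D & u = v \/ adj u v.

Inductive player := Dominator | Staller.

Definition unplayed (D S : {set G}) : {set G} := ~: (D :|: S).

Definition legal_move (bias : nat) (D S M : {set G}) : Prop :=
  M \subset unplayed D S /\ #|M| = minn bias #|unplayed D S|.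

(* dominator_wins a b p D S: in the (a,b)-biased game, Dominator can force a win
   from the position in which D and S are the sets of vertices already selected
   by Dominator and Staller, and p is the player to move. The game ends when
   every vertex has been played. *)
Inductive dominator_wins (a b : nat) : player -> {set G} -> {set G} -> Prop :=
| WinsEnd p D S :
    unplayed D S = set0 -> dominating D -> dominator_wins a b p D S
| WinsDominator D S M :
    unplayed D S != set0 -> legal_move a D S M ->
    dominator_wins a b Staller (D :|: M) S ->
    dominator_wins a b Dominator D S
| WinsStaller D S :
    unplayed D S != set0 ->
    (forall M, legal_move b D S M ->
       dominator_wins a b Dominator D (S :|: M)) ->
    dominator_wins a b Staller D S.

Definition dominator_wins_Sgame (a b : nat) : Prop :=
  dominator_wins a b Staller set0 set0.

Definition Sgame_threshold (l : nat) : enat :=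
  least (fun a => 0 < a /\ dominator_wins_Sgame a l).

End Game.

(* K_{1,r}, with centre ord0 *)
Definition star_rel (r : nat) : rel 'I_r.+1 :=
  fun i j => (i == ord0) != (j == ord0).

Lemma star_sym r : symmetric (@star_rel r).
Proof. by move=> i j; rewrite /star_rel eq_sym. Qed.

Lemma star_irrefl r : irreflexive (@star_rel r).
Proof. by move=> i; rewrite /star_rel eqxx. Qed.

Definition star (r : nat) : sgraph := SGraph (@star_sym r) (@star_irrefl r).

(* The subgraph of G induced by S has a spanning subgraph isomorphic to H *)
Definition spanned_by (G : sgraph) (S : {set G}) (H : sgraph) : Prop :=
  exists f : H -> G,
    [/\ injective f, f @: [set: H] = S &
        forall x y : H, adj x y -> adj (f x) (f y)].

Definition is_star_partition (G : sgraph) (k : nat) (P : {set {set G}}) : Prop :=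
  partition P [set: G] /\
  forall S, S \in P ->
    2 <= #|S| /\
    exists r, [/\ 1 <= r, #|star r| <= k.+1 & spanned_by S (star r)].

Definition star_partition_width (G : sgraph) : enat :=
  least (fun k => 0 < k /\ exists P, @is_star_partition G k P).

(* Main.v *)
Require Import Defs.
From mathcomp Require Import all_boot.
From mathcomp Require boolp.
From mathcomp Require Import zify.

(**
Given a k-star partition, Dominator answers a move in a star by taking the rest
of that star; he misses at most one vertex of each star, so he dominates.

Conversely, in a forest without an a-star partition there are disjoint sets X, Y
with N(X) included in Y and |X| > a|Y|.  Staller wins from such a pair by
induction on |Y|: the forest of edges between X and Y has a vertex v all of whose
neighbours but at most one are leaves.  Unless v is in Y with at least a pendant
neighbours in X, a vertex of Y can be dropped together with at most a vertices
of X.  Otherwise Staller plays v, which forces Dominator to spend his whole move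
on the pendant neighbours of v.
*)

Set Implicit Arguments.
Unset Strict Implicit.
Unset Printing Implicit Defensive.

(** * Least values and auxiliary facts on finite sets *)

Lemma least_spec (P : nat -> Prop) n : P n ->
  exists2 m, least P = Some m & P m /\ m <= n.
Proof.
move=> Pn; rewrite /least; case: boolp.pselect => [exP|[]]; last by exists n.
case: ex_minnP => m /boolp.asboolP Pm min_m; exists m => //; split=> //.
exact/min_m/boolp.asboolP.
Qed.

Lemma least_le (P Q : nat -> Prop) :
  (forall n, Q n -> P n) -> enat_le (least P) (least Q).
Proof.
move=> sQP; rewrite {2}/least; case: boolp.pselect => [exQ|_]; last first.
  by case: (least P).
case: ex_minnP => m /boolp.asboolP /sQP Pm _.
by have [m' -> []] := least_spec Pm.
Qed.

Lemma eq_least (P Q : nat -> Prop) :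
  (forall n, P n <-> Q n) -> least P = least Q.
Proof.
by move=> eqPQ; congr least; apply/boolp.funext => n; apply/boolp.propext.
Qed.

(** A legal move has a prescribed size, so the vertices a player really wants must be padded with
    arbitrary unplayed ones. *)
Lemma subset_card_between (T : finType) (A B : {set T}) n :
  A \subset B -> #|A| <= n -> n <= #|B| ->
  exists M : {set T}, [/\ A \subset M, M \subset B & #|M| = n].
Proof.
move=> sAB leAn lenB; rewrite -(subnKC leAn) in lenB *.
elim: (n - #|A|) lenB => [|m IH] ltmB; first by exists A; rewrite addn0.
have [|M [sAM sMB cardM]] := IH; first by lia.
have /properP[_ [x xB xM]] : M \proper B.
  by rewrite properEcard sMB cardM; lia.
exists (x |: M); split; last by rewrite cardsU1 xM cardM; lia.
  exact: subset_trans (subsetUr _ _).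
by rewrite subUset sub1set xB.
Qed.

Lemma disjoint_setUr (T : finType) (A B C : {set T}) :
  [disjoint A & B :|: C] = [disjoint A & B] && [disjoint A & C].
Proof. by rewrite -!setI_eq0 setIUr setU_eq0. Qed.

(** * Star partitions described through centres *)

Section Graph.
Variable G : sgraph.
Implicit Types (C D S M W X Y L U : {set G}) (u v w x y z : G).

Definition star_set k S : Prop :=
  1 < #|S| <= k.+1 /\
  exists2 c, c \in S & forall x, x \in S -> x != c -> adj c x.

Lemma star_spanP k S :
  (2 <= #|S| /\ exists r, [/\ 1 <= r, #|star r| <= k.+1 & spanned_by S (star r)])
  <-> star_set k S.
Proof.
split=> [[S2 [r [r1 rk [f [finj fS fadj]]]]]|[/andP[S2 Sk] [c cS cadj]]].
  have cardS : #|S| = #|star r| by rewrite -fS card_imset // cardsT.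
  split; first by rewrite S2 cardS.
  exists (f ord0); first by rewrite -fS imset_f ?inE.
  move=> x; rewrite -fS => /imsetP[i _ ->] fi; apply: fadj.
  by rewrite /= /star_rel eqxx; case: (i =P ord0) fi => [->|]; rewrite ?eqxx.
split=> //; exists #|S :\ c|.
have cardS : #|S| = #|S :\ c|.+1 by rewrite (cardsD1 c S) cS.
split; [lia | by rewrite card_ord -cardS|].
(* The default value of [oapp] is the image of [ord0], so the centre goes to [c] and the leaves
   enumerate the other vertices of [S]. *)
pose f (i : 'I_#|S :\ c|.+1) := oapp (@enum_val _ (mem (S :\ c))) c (unlift ord0 i).
have f0 : f ord0 = c by rewrite /f unlift_none.
have fS j : f (lift ord0 j) \in S :\ c by rewrite /f liftK /= enum_valP.
have finj : injective f.
  move=> i j; case: (unliftP ord0 i) => [i'|] ->;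
    case: (unliftP ord0 j) => [j'|] -> //; rewrite ?f0.
  - by rewrite /f !liftK /= => /enum_val_inj ->.
  - by move=> e; have := fS i'; rewrite e !inE eqxx.
  - by move=> e; have := fS j'; rewrite -e !inE eqxx.
exists f; split => //.
  apply/eqP; rewrite eqEcard; apply/andP; split.
    apply/subsetP => _ /imsetP[i _ ->]; case: (unliftP ord0 i) => [i'|] ->.
      by have := fS i'; rewrite inE => /andP[].
    by rewrite f0.
  by rewrite card_imset // cardsT card_ord cardS.
move=> i j; rewrite /= /star_rel.
case: (unliftP ord0 i) => [i'|] ->;
  case: (unliftP ord0 j) => [j'|] ->; rewrite ?f0 ?eqxx //= => _.
- rewrite adj_sym; have := fS i'; rewrite !inE => /andP[ne ?]; exact: cadj.
- have := fS j'; rewrite !inE => /andP[ne ?]; exact: cadj.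
Qed.

Definition star_partitionable k W : Prop :=
  exists2 P : {set {set G}}, partition P W & forall S, S \in P -> star_set k S.

Lemma star_partitionE k :
  (exists P, @is_star_partition G k P) <-> star_partitionable k [set: G].
Proof.
split=> [[P [partP starP]]|[P partP starP]]; exists P => //.
  by move=> S /starP /star_spanP.
by split=> // S /starP /star_spanP.
Qed.

(** * Dominator's pairing-type strategy on a star partition *)

Lemma star_set_dominated k D S x :
  star_set k S -> #|S :\: D| <= 1 -> x \in S ->
  exists2 u, u \in D & u = x \/ adj u x.
Proof.
move=> [/andP[S2 _] [c cS cadj]] /card_le1_eqP SD1 xS.
have [xD|xD] := boolP (x \in D); first by exists x; [|left].
have other y : y \in S -> y != x -> y \in D.
  move=> yS; apply: contraNT => yD; apply/eqP.
  by apply: SD1; rewrite inE ?xD ?yD.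
(* A missed leaf is dominated by the centre, and a missed centre by any leaf; a leaf exists since
   [S] has at least two elements. *)
have [xc|xc] := eqVneq x c; last first.
  by exists c; [apply: other; rewrite // eq_sym | right; apply: cadj].
have [y yS yx] : exists2 y, y \in S & y != x.
  by have /card_gt1P[y [z [yS zS yz]]] := S2;
    have [e|] := eqVneq y x; [exists z; rewrite // -e eq_sym|exists y].
by exists y; [apply: other|right; rewrite adj_sym xc cadj // -xc].
Qed.

Lemma star_partition_wins k :
  star_partitionable k [set: G] -> dominator_wins_Sgame G k 1.
Proof.
move=> [P partP starP]; rewrite /dominator_wins_Sgame.
have ends p D S : unplayed D S = set0 ->
    (forall A, A \in P -> #|A :&: S| <= 1) -> dominator_wins k 1 p D S.
  move=> U0 PS; apply: WinsEnd => // v.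
  have : v \in cover P by rewrite (cover_partition partP).
  case/bigcupP=> A AP vA; apply: (star_set_dominated (starP _ AP)) vA.
  apply: leq_trans (PS _ AP); apply/subset_leq_card/subsetP => x.
  rewrite !inE => /andP[xD ->]; have := in_set0 x.
  by rewrite -U0 !inE (negPf xD) /= => /negbFE.
(* Invariant whenever Staller is to move: she owns at most one vertex of each star, and a star she
   has touched is completely played. *)
have main n D S : #|unplayed D S| < n ->
    (forall A, A \in P -> #|A :&: S| <= 1) ->
    (forall A, A \in P -> A :&: S != set0 -> A \subset D :|: S) ->
    dominator_wins k 1 Staller D S.
  elim: n D S => // n IH D S leUn PS PDS.
  have [U0|Un0] := eqVneq (unplayed D S) set0; first exact: ends.
  apply: WinsStaller => // M [subM cardM].
  have /cards1P[v Mv] : #|M| == 1.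
    by rewrite cardM; move: Un0; rewrite -card_gt0; lia.
  have vU : v \in unplayed D S by move/subsetP: subM; apply; rewrite Mv set11.
  have vDS : v \notin D :|: S by rewrite -in_setC.
  have : v \in cover P by rewrite (cover_partition partP).
  case/bigcupP=> A AP vA.
  have AS0 : A :&: S = set0.
    by apply/eqP; apply: contraNT vDS => /(PDS _ AP)/subsetP; apply.
  have PSv B : B \in P -> #|B :&: (S :|: M)| <= 1.
    move=> BP; have [->|BA] := eqVneq B A.
      by rewrite setIUr AS0 set0U Mv (leq_trans (subset_leq_card (subsetIr _ _))) ?cards1.
    rewrite setIUr [B :&: M](_ : _ = set0) ?setU0 ?PS //.
    apply/eqP; rewrite setI_eq0 Mv disjoint_sym disjoints1; apply: contra BA => vB.
    have tP := partition_trivIset partP.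
    by rewrite -(def_pblock tP BP vB) (def_pblock tP AP vA).
  set S' := S :|: M in PSv *.
  have [U0|U'n0] := eqVneq (unplayed D S') set0; first exact: ends.
  have [/andP[_ Ak] _] := starP _ AP.
  (* The star [A] has order at most [k.+1] and [v] is gone from it, so the rest fits into one move
     of Dominator. *)
  have AU : #|A :&: unplayed D S'| <= minn k #|unplayed D S'|.
    rewrite leq_min subset_leq_card ?subsetIr // andbT -ltnS (leq_trans _ Ak) //.
    rewrite (cardsD1 v A) vA ltnS; apply/subset_leq_card/subsetP => x.
    rewrite /S' Mv !inE => /andP[->]; rewrite !negb_or andbT.
    by case/andP=> _ /andP[].
  have [M' [AM' M'U cardM']] : exists M' : {set G},
      [/\ A :&: unplayed D S' \subset M', M' \subset unplayed D S' &
          #|M'| = minn k #|unplayed D S'|].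
    by apply: subset_card_between AU _; rewrite ?subsetIr ?geq_minr.
  apply: (WinsDominator U'n0 (M := M')) => //.
  apply: IH => //.
    rewrite -ltnS; apply: leq_trans leUn; rewrite ltnS; apply: proper_card.
    apply/properP; split; first by apply/subsetP => x; rewrite !inE; do !case: (_ \in _).
    by exists v => //; rewrite /S' Mv !inE eqxx !orbT.
  move=> B BP; have [->|BA] := eqVneq B A => BS'.
    apply/subsetP => x xA; have := subsetP AM' x; rewrite !inE xA /=.
    by do !case: (_ \in _) => //=; move=> /(_ isT).
  have : B :&: S != set0.
    case/set0Pn: BS' => x; rewrite /S' Mv !inE => /andP[xB /orP[xS|/eqP xv]].
      by apply/set0Pn; exists x; rewrite inE xB.
    have tP := partition_trivIset partP; rewrite xv in xB.
    by rewrite -(def_pblock tP BP xB) (def_pblock tP AP vA) eqxx in BA.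
  move/(PDS _ BP)/subset_trans; apply.
  by apply/subsetP => x; rewrite !inE; do !case: (_ \in _).
apply: (main _ _ _ (ltnSn _)) => A AP; rewrite setI0 ?cards0 //.
by rewrite eqxx.
Qed.

(** * Leaves and penultimate vertices of forests *)

Lemma acyclic_degenerate W :
  acyclic G -> W != set0 -> exists2 v, v \in W & #|[set u in W | adj v u]| <= 1.
Proof.
move=> acycG /set0Pn[w wW].
(* Minimum degree 2 would let every path be extended at its head. *)
apply/exists_inP; apply: contraT => /exists_inPn deg2.
suff long n : exists x p, [/\ path (@adj G) x p, uniq (x :: p),
    {subset x :: p <= W} & size p = n].
  have [x [p [_ /card_uniqP cardp _ sizep]]] := long #|G|.
  by have := max_card (mem (x :: p)); rewrite cardp /= sizep ltnn.
elim: n => [|n [x [p [pathp uniqp subp sizep]]]].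
  by exists w, [::]; split=> // y /[1!inE] /eqP->.
have xW : x \in W by apply: subp; rewrite mem_head.
have [z zW [xz zp]] : exists2 z, z \in W & adj x z /\ z != head x p.
  have := deg2 x xW; rewrite -ltnNge => /card_gt1P[y [z []]].
  rewrite !inE => /andP[yW xy] /andP[zW xz] yz.
  have [e|] := eqVneq y (head x p); last by exists y.
  by exists z; rewrite // -e eq_sym.
have zx : z != x by apply: contraTneq xz => ->; rewrite adj_irrefl.
have [zp'|zp'] := boolP (z \in p); last first.
  exists z, (x :: p); split=> [| | y |]; rewrite /= ?sizep ?pathp ?(adj_sym z) ?xz //.
    by rewrite inE negb_or zx zp'.
  by rewrite inE => /predU1P[->|/subp].
(* When [z] is already on the path, the segment from [x] to [z] closes to a cycle. It has at least
   three vertices because [z] is not the successor of [x]. *)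
case/splitPr: zp' pathp uniqp zp => p1 p2 pathp uniqp zp; exfalso.
apply: (acycG (x :: rcons p1 z)).
  by case: p1 zp {pathp uniqp} => [|? ?]; rewrite /= ?size_rcons ?eqxx.
rewrite /ucycle /= rcons_path last_rcons (adj_sym z) xz andbT.
move: pathp uniqp; rewrite -cat_rcons cat_path /= cat_uniq mem_cat.
by case/andP=> -> _ /and3P[/norP[-> _] ->].
Qed.

Definition pendants (e : rel G) W v : {set G} :=
  [set w in W | e v w && [forall z in W, e w z ==> (z == v)]].

(** If no vertex has two neighbours, all edges are isolated and any vertex will do. Otherwise delete
    the vertices of degree at most 1 and take [v] with at most one neighbour among the remaining
    ones: its deleted neighbours are pendant, and there is one because [v] had degree at least 2.
    The relation [e] is a parameter since the game needs the edges between two sets only. *)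
Lemma penultimate_vertex (e : rel G) W :
  acyclic G -> subrel e (@adj G) -> symmetric e -> W != set0 ->
  (forall x, x \in W -> exists2 y, y \in W & e x y) ->
  exists2 v, v \in W & pendants e W v != set0 /\
    #|[set w in W | e v w] :\: pendants e W v| <= 1.
Proof.
move=> acycG sub_e sym_e Wn0 iso.
have degen U : U != set0 -> exists2 v, v \in U & #|[set u in U | e v u]| <= 1.
  move=> /(acyclic_degenerate acycG)[v vU le1]; exists v => //.
  apply: leq_trans le1; apply/subset_leq_card/subsetP => u.
  by rewrite !inE => /andP[-> /sub_e].
pose nb v := [set w in W | e v w].
have nbP v x : v \in W -> e x v -> #|nb x| <= 1 -> [forall z in W, e x z ==> (z == v)].
  move=> vW xv /card_le1_eqP le1; apply/forall_inP => z zW; apply/implyP => xz.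
  by apply/eqP; apply: le1; rewrite inE ?zW ?vW.
pose W' := [set v in W | 1 < #|nb v|].
have [W'0|/degen[v]] := eqVneq W' set0.
  have nb1 v : v \in W -> #|nb v| <= 1.
    by move=> vW; rewrite leqNgt; apply/negP => lt1; have := in_set0 v; rewrite -W'0 inE vW lt1.
  have /set0Pn[v vW] := Wn0; exists v => //; split.
    have [l lW vl] := iso v vW; apply/set0Pn; exists l; rewrite inE lW vl.
    by apply: nbP; rewrite 1?sym_e ?nb1.
  exact: leq_trans (subset_leq_card (subsetDl _ _)) (nb1 v vW).
rewrite inE => /andP[vW lt1] le1; exists v => //.
have sub : nb v :\: pendants e W v \subset [set u in W' | e v u].
  apply/subsetP => u; rewrite !inE => /andP[pu /andP[uW vu]].
  rewrite uW vu andbT /=; move: pu; rewrite uW vu /= ltnNge; apply: contra => u1.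
  by apply: nbP; rewrite // sym_e.
have le1' := leq_trans (subset_leq_card sub) le1; split=> //.
by apply: contraTneq lt1 => p0; rewrite -leqNgt; move: le1'; rewrite p0 setD0.
Qed.

(** * Deficient pairs as the obstruction to star partitions *)

(** A Hall-type obstruction: no edge joins two vertices of [X], so for positive [a] a star of order
    at most [a.+1] inside [W] that meets [X] contains a vertex of [Y] and at most [a] vertices of
    [X]. *)
Definition deficient a W X Y : Prop :=
  [/\ X \subset W /\ Y \subset W, [disjoint X & Y],
      forall x y, x \in X -> y \in W -> adj x y -> y \in Y & a * #|Y| < #|X|].

(** Induction on [W], with [v] a penultimate vertex, [L] its pendant neighbours and [U] its other
    neighbours, at most one. If [L] has more than [a] elements, it is deficient against [v]. If it
    has exactly [a], the star on [v] and [L] is split off, and a deficient pair of the rest absorbs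
    [L] and [v]. If it has fewer, the star may or may not take the vertex of [U] as well, and both
    remainders are examined. *)
Lemma star_partition_or_deficient a W : acyclic G -> 0 < a ->
  star_partitionable a W \/ exists X Y, deficient a W X Y.
Proof.
move=> acycG a_gt0; have [n] := ubnP #|W|; elim: n W => // n IH W leWn.
have [->|Wn0] := eqVneq W set0.
  by left; exists set0 => [|S]; rewrite ?partition_set0 ?inE.
have [/exists_inP[x xW /forall_inP isox]|] :=
    boolP [exists x in W, [forall y in W, ~~ adj x y]].
  right; exists [set x], set0; split; rewrite ?sub0set ?sub1set ?cards0 ?cards1 ?muln0 //.
    by rewrite disjoints1 inE.
  by move=> _ y /set1P-> /isox /negPf->.
rewrite negb_exists_in => /forall_inP noiso.
have [|v vW [pn0]] := penultimate_vertex acycG (fun x y => id) (@adj_sym G) Wn0.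
  by move=> x /noiso; rewrite negb_forall_in => /exists_inP[y yW /negbNE]; exists y.
set L := pendants _ W v in pn0 *; set U := _ :\: L => U1.
have LP l : l \in L -> [/\ l \in W, adj v l & forall z, z \in W -> adj l z -> z = v].
  rewrite inE => /and3P[lW vl /forall_inP lz]; split=> // z /lz /implyP imp /imp.
  by move/eqP.
have UP u : (u \in U) = [&& u \notin L, u \in W & adj v u] by rewrite !inE.
clearbody U L; have vL : v \notin L by apply/negP => /LP[_]; rewrite adj_irrefl.
have sLW : L \subset W by apply/subsetP => l /LP[].
have L_gt0 : 0 < #|L| by rewrite card_gt0.
have star_add C : C \subset W -> L \subset C -> {subset C <= L :|: U} -> #|C| <= a ->
    star_partitionable a (W :\: (v |: C)) -> star_partitionable a W.
  move=> sCW sLC sC leCa [P partP starP]; pose S := v |: C.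
  have vC : v \notin C.
    by apply/negP => /sC; rewrite inE (negPf vL) UP adj_irrefl !andbF.
  have SW : S :|: (W :\: S) = W.
    by rewrite -[RHS](setID W S) (setIidPr _) // subUset sub1set vW.
  exists (S |: P).
    rewrite -[X in partition _ X]SW partitionU1 //.
      by apply/set0Pn; exists v; rewrite !inE eqxx.
    by rewrite disjoint_sym -setI_eq0 setIC setIDA setDIl setDv set0I.
  move=> A /setU1P[->|/starP//]; split.
    by rewrite cardsU1 vC add1n !ltnS leCa andbT (leq_trans L_gt0 (subset_leq_card sLC)).
  exists v; first by rewrite !inE eqxx.
  move=> x /setU1P[->|/sC]; first by rewrite eqxx.
  by rewrite inE UP => /orP[/LP[]|/and3P[]].
have smaller C : #|W :\: (v |: C)| < n.
  rewrite -ltnS; apply: leq_trans leWn; rewrite ltnS; apply: proper_card.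
  apply/properP; split; first exact: subsetDl.
  by exists v => //; rewrite !inE eqxx.
have nonadjL x y : x \in W :\: (v |: L) -> y \in L -> adj x y = false.
  rewrite !inE negb_or -andbA => /and3P[xv _ xW] /LP[_ _] yz.
  by apply: contraNF xv; rewrite adj_sym => /yz->.
have nonadjv x : x \in W :\: (v |: L) -> x \notin U -> adj x v = false.
  by rewrite UP !in_setD in_setU1 negb_or -andbA => /and3P[_ -> ->] /negPf; rewrite adj_sym.
case: (ltngtP #|L| a) => [ltLa|gtLa|eqLa].
- case: (IH (W :\: (v |: L))) => // [starW|[X [Y [[sXW sYW] dXY nbX defXY]]]].
    by left; apply: star_add starW => //; [move=> x; rewrite inE => ->|exact: ltnW].
  (* A vertex of [X] outside [U] sees neither [v] nor [L], so if [X] misses [U] the pair is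
     deficient in all of [W]. *)
  have [XU0|] := eqVneq (X :&: U) set0.
    right; exists X, Y; split=> //.
      by rewrite (subset_trans sXW) ?(subset_trans sYW) ?subsetDl.
    move=> x y xX yW xy; have xW := subsetP sXW x xX; apply: (nbX x) => //.
    rewrite !inE negb_or yW andbT; apply/andP; split; last first.
      by apply: contraTN xy => /(nonadjL _ _ xW)->.
    apply: contraTneq xy => ->; rewrite nonadjv //; apply/negP => xU.
    by have := in_set0 x; rewrite -XU0 inE xX xU.
  case/set0Pn=> u /setIP[uX uU].
  have {}U1 : U = [set u].
    by apply/eqP; rewrite eq_sym eqEcard sub1set uU cards1.
  case: (IH (W :\: (v |: (L :|: U)))) => // [starW|[X2 [Y2 [[sXW2 sYW2] dXY2 nbX2 defXY2]]]].
    left; apply: star_add starW => //.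
      by rewrite subUset sLW U1 sub1set; move: uU; rewrite UP => /and3P[].
      exact: subsetUl.
    by rewrite (leq_trans (leq_card_setU _ _)) // U1 cards1 addn1.
  right.
  (* [(X, Y)] is deficient in [W1 = W - v - L] and [(X2, Y2)] in [W1 - u].
     Neither [X \ (u |: Y2)] nor [X2 \ Y] has [u] or [v] as a neighbour, so one
     of [(X \ (u |: Y2), Y \ X2)], [(X2 \ Y, Y2 \ X)] is deficient in [W]. *)
  have XS := subsetP sXW; have X2S := subsetP sXW2.
  have YS := subsetP sYW; have Y2S := subsetP sYW2.
  have [uY2 uX2] : u \notin Y2 /\ u \notin X2.
    by split; [apply/negP => /Y2S|apply/negP => /X2S]; rewrite !inE uU !orbT.
  have W2E y : (y \in W :\: (v |: (L :|: U))) = (y != u) && (y \in W :\: (v |: L)).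
    by rewrite U1 !inE !negb_or -!andbA; do !bool_congr.
  have WE y : y \in W -> y \in W :\: (v |: L) \/ y = v \/ y \in L.
    move=> yW; rewrite !inE yW andbT negb_or; case: eqP => [|_]; first by right; left.
    by case: (_ \in L); [right; right|left].
  have clos x y : x \in W :\: (v |: L) -> x != u -> y \in W -> adj x y -> y \in W :\: (v |: L).
    move=> xW xu yW xy; have [//|[yv|yL]] := WE y yW.
      by move: xy; rewrite yv nonadjv // U1 inE.
    by rewrite (nonadjL x) in xy.
  have [lt1|le1] := ltnP (a * #|Y :\: X2|) #|X :\: (u |: Y2)|.
    exists (X :\: (u |: Y2)), (Y :\: X2); split=> //.
    - by rewrite !(subset_trans (subsetDl _ _)) // (subset_trans _ (subsetDl W (v |: L))).
    - exact: disjointW (subsetDl _ _) (subsetDl _ _) dXY.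
    move=> x y; rewrite !inE negb_or -andbA => /and3P[xu xY2 xX] yW xy.
    have yW1 := clos _ _ (XS x xX) xu yW xy.
    rewrite (nbX x) // andbT; apply: contra xY2 => yX2; apply: (nbX2 y) => //.
      by rewrite W2E xu XS.
    by rewrite adj_sym.
  exists (X2 :\: Y), (Y2 :\: X); split=> //.
  - by rewrite !(subset_trans (subsetDl _ _)) // (subset_trans _ (subsetDl W (v |: (L :|: U)))).
  - exact: disjointW (subsetDl _ _) (subsetDl _ _) dXY2.
  - move=> x y; rewrite !inE => /andP[xY xX2] yW xy.
    have := X2S x xX2; rewrite W2E => /andP[xu xW1].
    have yW1 := clos _ _ xW1 xu yW xy.
    have yX : y \notin X.
      by apply: contra xY => yX; apply: (nbX y); rewrite // adj_sym.
    rewrite yX; apply: (nbX2 x) => //; rewrite W2E yW1 andbT.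
    by apply: contraNneq yX => ->.
  (* If the first pair fails, then [a * #|Y :&: X2| <= #|X :&: Y2|]; the strictness of [defXY] pays
     for [u]. Since [a] is positive, [#|Y :&: X2| <= a * #|X :&: Y2|], so removing these two
     intersections from [X2] and [Y2] keeps the strict inequality. *)
  have := cardsID X2 Y; have := cardsID X Y2; have := cardsID Y X2.
  have := cardsID (u |: Y2) X.
  have := subset_leq_card (_ : X :&: (u |: Y2) \subset u |: (Y2 :&: X)).
  rewrite cardsU1 (setIC X2 Y) => le2.
  have {}le2 : #|X :&: (u |: Y2)| <= 1 + #|Y2 :&: X|.
    apply: leq_trans (le2 _) _; last by rewrite leq_add2r leq_b1.
    by apply/subsetP => x; rewrite !inE => /andP[->]; rewrite andbT.
  move: defXY defXY2 le1 le2; clear -a_gt0; nia.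
- right; exists L, [set v]; split; rewrite ?sLW ?sub1set ?cards1 ?muln1 //.
    by rewrite disjoint_sym disjoints1.
  by move=> x y /LP[_ _] xv yW /xv->; rewrite ?set11.
case: (IH (W :\: (v |: L))) => // [starW|[X [Y [[sXW sYW] dXY nbX defXY]]]].
  by left; apply: star_add starW; rewrite ?eqLa // => x; rewrite inE => ->.
right; exists (X :|: L), (v |: Y).
have XS := subsetP sXW; have YS := subsetP sYW.
have notin x : x \in W :\: (v |: L) -> x != v /\ x \notin L.
  by rewrite !inE negb_or -andbA => /and3P[].
have vY : v \notin Y by apply/negP => /YS/notin[]; rewrite eqxx.
have dXL : [disjoint X & L].
  by apply/pred0P => x /=; apply/negP => /andP[/XS/notin[_ /negP]].
split.
- split; first by rewrite subUset sLW andbT (subset_trans sXW) ?subsetDl.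
  by rewrite subUset sub1set vW (subset_trans sYW) ?subsetDl.
- apply/pred0P => x /=; rewrite !inE; apply/negP => /andP[/orP[xX|xL] /orP[/eqP xv|xY]].
  + by have /notin[] := XS x xX; rewrite xv eqxx.
  + by have := disjointFr dXY xX; rewrite xY.
  + by rewrite -xv xL in vL.
  + by have /notin[_ /negP] := YS x xY.
- move=> x y /setUP[xX|/LP[_ _] xz] yW xy; last by rewrite (xz y) ?setU11.
  rewrite !inE; have [//|yv /=] := eqVneq y v; apply: (nbX x) => //.
  rewrite !inE yW (negPf yv) andbT; apply: contraTN xy => yL.
  by rewrite (nonadjL x) ?XS.
rewrite cardsU1 vY cardsU (eqP (_ : X :&: L == set0)) ?setI_eq0 // cards0.
by rewrite subn0 eqLa mulnDr muln1 addnC ltn_add2r.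
Qed.

(** * Staller's strategy on a deficient pair *)

Lemma staller_claims a b p D S x :
  x \notin D -> x \in S -> (forall y, adj x y -> y \in S) -> [disjoint D & S] ->
  ~ dominator_wins a b p D S.
Proof.
move=> xD xS nbS dDS win; elim: win xD xS nbS dDS => {p D S}.
- move=> _ D S _ dom xD _ nbS dDS; have [u uD [ux|ux]] := dom x.
    by rewrite -ux uD in xD.
  by have := disjointFr dDS uD; rewrite nbS // adj_sym.
- move=> D S M _ [subM _] _ IH xD xS nbS dDS; apply: IH => //.
    apply: contraNN xD => /setUP[//|/(subsetP subM)].
    by rewrite !inE xS orbT.
  apply/pred0P => z /=; apply/negP => /andP[zDM zS].
  case/setUP: zDM => [zD|/(subsetP subM)].
    by have := disjointFr dDS zD; rewrite zS.
  by rewrite !inE zS orbT.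
move=> D S _ _ IH xD xS nbS dDS.
(* The premise of [WinsStaller] is universal in her move, so some legal move must be exhibited; any
   will do. *)
have [M subM cardM] : exists2 M : {set G}, M \subset unplayed D S &
    #|M| = minn b #|unplayed D S|.
  have [|||M [_ ? ?]] := @subset_card_between _ set0 (unplayed D S) (minn b #|unplayed D S|).
  - exact: sub0set.
  - by rewrite cards0.
  - exact: geq_minr.
  by exists M.
apply: (IH M) => //; first by rewrite inE xS.
  by move=> y /nbS yS; rewrite inE yS.
apply/pred0P => z /=; apply/negP => /andP[zD /setUP[zS|/(subsetP subM)]].
  by have := disjointFr dDS zD; rewrite zS.
by rewrite !inE zD.
Qed.

Lemma legal_move1 D S v : v \in unplayed D S -> legal_move 1 D S [set v].
Proof.
move=> vU; split; first by rewrite sub1set.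
by rewrite cards1 (minn_idPl _) // card_gt0; apply/set0Pn; exists v.
Qed.

(** This is the form of a threat: only [x] itself may still be missing from the closed
    neighbourhood, and Staller can select it at once. *)
Lemma staller_wins_next a D S x :
  x \notin D -> (forall y, adj x y -> y \in S) -> [disjoint D & S] ->
  ~ dominator_wins a 1 Staller D S.
Proof.
move=> xD nbS dDS; have [xS|xS] := boolP (x \in S).
  exact: staller_claims xS nbS dDS.
have xU : x \in unplayed D S by rewrite !inE negb_or xD.
move=> win; inversion win as [? ? ? U0 _| |? ? _ reply]; subst.
  by have := in_set0 x; rewrite -U0 xU.
apply: (staller_claims xD) (reply _ (legal_move1 xU)) => //.
- by rewrite !inE eqxx orbT.
- by move=> y /nbS yS; rewrite inE yS.
by rewrite disjoint_setUr dDS disjoint_sym disjoints1.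
Qed.

(** Stated for arbitrary positions so that the induction passes through moves. Neighbours of [X]
    outside [Y] already belong to Staller, so a vertex of [X] without neighbours in [Y] is an
    immediate win. *)
Lemma deficient_staller_wins a X Y D S :
  acyclic G -> 0 < a -> a * #|Y| < #|X| ->
  [disjoint X & Y] -> [disjoint X & D] -> [disjoint D & S] ->
  Y \subset unplayed D S ->
  (forall x y, x \in X -> adj x y -> y \in Y :|: S) ->
  ~ dominator_wins a 1 Staller D S.
Proof.
move=> acycG a_gt0; have [n] := ubnP #|Y|.
elim: n X Y D S => // n IH X Y D S leYn defXY dXY dXD dDS YU nbX.
have cardY1 y : y \in Y -> #|Y| = #|Y :\ y|.+1 by move=> yY; rewrite (cardsD1 y) yY.
(* No move is made here. Dropping [y] lowers the left side of [defXY] by [a], which pays for at most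
   [a] vertices of [X]; all neighbours of [y] must be among those. *)
have shrink X' y : X' \subset X -> y \in Y -> #|X :\: X'| <= a ->
    (forall x, x \in X' -> ~ adj x y) -> ~ dominator_wins a 1 Staller D S.
  move=> sX' yY leXa nb'; apply: (IH X' (Y :\ y)).
  - by move: leYn; rewrite (cardY1 y).
  - have := cardsID X' X; rewrite (setIidPr sX').
    by move: defXY leXa; rewrite (cardY1 y yY) mulnS; lia.
  - exact: disjointW sX' (subsetDl _ _) dXY.
  - exact: disjointW sX' (subxx _) dXD.
  - by [].
  - exact: subset_trans (subsetDl _ _) YU.
  move=> x z xX' xz; have := nbX x z (subsetP sX' x xX') xz; rewrite !inE.
  by case: eqP xz => //= -> /(nb' _ xX').
have [/exists_inP[x xX /forall_inP isox]|] :=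
    boolP [exists x in X, [forall y in Y, ~~ adj x y]].
  apply: (staller_wins_next (x := x)) => //; first by rewrite (disjointFr dXD).
  move=> y xy; have /setUP[yY|//] := nbX x y xX xy.
  by have := isox y yY; rewrite xy.
rewrite negb_exists_in => /forall_inP noX.
have [/exists_inP[y yY /forall_inP isoy]|] :=
    boolP [exists y in Y, [forall x in X, ~~ adj x y]].
  apply: (shrink X y) => //; first by rewrite setDv cards0.
  by move=> x /isoy/negPf->.
rewrite negb_exists_in => /forall_inP noY.
(* Edges inside [Y] are discarded, since they have no bearing on which vertices of [X] are
   pendant. *)
pose e x y := adj x y && ((x \in X) && (y \in Y) || (x \in Y) && (y \in X)).
have sym_e : symmetric e.
  by move=> x y; rewrite /e adj_sym orbC andbC [in RHS]andbC ![(x \in _) && _]andbC.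
have [||x|v vXY [/set0Pn[l0 l0L] le1]] := @penultimate_vertex e (X :|: Y) acycG _ sym_e.
- by move=> x y /andP[].
- by rewrite -card_gt0 (leq_trans _ (subset_leq_card (subsetUl X Y))) //; lia.
- case/setUP=> [xX|xY].
    have := noX x xX; rewrite negb_forall_in => /exists_inP[y yY /negbNE xy].
    by exists y; rewrite /e ?inE ?xX ?yY ?xy ?orbT.
  have := noY x xY; rewrite negb_forall_in => /exists_inP[y yX /negbNE xy].
  by exists y; rewrite /e ?inE ?xY ?yX ?[adj x y]adj_sym ?xy ?orbT.
set L := pendants _ _ _ in l0L le1.
have LP l : l \in L -> [/\ l \in X :|: Y, e v l &
    forall z, z \in X :|: Y -> e l z -> z = v].
  rewrite inE => /and3P[lW vl /forall_inP lz]; split=> // z /lz /implyP imp /imp.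
  by move/eqP.
(* If [v] is in [X], a pendant neighbour [l0] lies in [Y] and sees only [v] in [X]; dropping both
   costs one vertex of [X]. *)
have [vX|vX] := boolP (v \in X).
  have [_ vl lz] := LP l0 l0L.
  have l0Y : l0 \in Y.
    by move: vl; rewrite /e vX (disjointFr dXY vX) orbF => /and3P[].
  apply: (shrink (X :\ v) l0); rewrite ?subsetDl //.
    by rewrite setDDr setDv set0U (leq_trans (subset_leq_card (subsetIr _ _))) ?cards1.
  move=> x /setD1P[/eqP xv xX] xl; apply: xv; apply: lz; rewrite ?inE ?xX //.
  by rewrite sym_e /e xl xX l0Y.
have vY : v \in Y by move: vXY; rewrite inE (negPf vX).
have eE x : x \in X -> e v x = adj x v.
  by move=> xX; rewrite /e [adj v x]adj_sym xX vY (negPf vX) /= andbT.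
have LX l : l \in L -> l \in X.
  by case/LP=> _; rewrite /e vY (negPf vX) => /andP[].
have nbL l y : l \in L -> adj l y -> y \in v |: S.
  move=> lL ly; have [_ _ lz] := LP l lL.
  have /setUP[yY|yS] := nbX l y (LX l lL) ly; last by rewrite !inE yS orbT.
  by rewrite (lz y) ?setU11 // ?inE ?yY ?orbT // /e ly (LX l lL) yY.
have [ltLa|leaL] := ltnP #|L| a.
  apply: (shrink [set x in X | ~~ adj x v] v) => //.
  - by apply/subsetP => x; rewrite inE => /andP[].
  - apply: leq_trans ltLa; rewrite -addn1.
    apply: leq_trans (leq_add (leqnn _) le1); apply: leq_trans (leq_card_setU _ _).
    apply/subset_leq_card/subsetP => x /setDP[xX]; rewrite inE xX negbK /= => xv.
    by rewrite in_setU in_setD; case: (x \in L); rewrite // !inE xX eE.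
  by move=> x; rewrite inE => /andP[_ /negPf->].
have vU := subsetP YU v vY.
move=> win; inversion win as [? ? ? U0 _| |? ? _ reply]; subst.
  by have := in_set0 v; rewrite -U0 vU.
have {win reply} win := reply _ (legal_move1 vU).
have vD : v \notin D by move: vU; rewrite !inE => /norP[].
have dDSv : [disjoint D & S :|: [set v]].
  by rewrite disjoint_setUr dDS disjoint_sym disjoints1.
(* After Staller plays [v], every neighbour of a vertex of [L] is hers, so Dominator must take all
   of [L] at once. *)
have threat l D' : l \in L -> l \notin D' -> [disjoint D' & S :|: [set v]] ->
    ~ dominator_wins a 1 Staller D' (S :|: [set v]).
  by move=> lL lD' dD'; apply: staller_wins_next lD' _ dD' => y; rewrite setUC; apply: nbL.
(* If the board is full after [v], [WinsEnd] applies with either player to move, so the position may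
   be read as Staller's turn and contradicts the threat. *)
inversion win as [? ? ? U0 dom|? ? M _ [subM cardM] win'| ]; subst.
  have l0D : l0 \notin D by rewrite (disjointFr dXD) ?LX.
  by apply: (threat l0 D) => //; apply: WinsEnd.
have dM : [disjoint D :|: M & S :|: [set v]].
  rewrite disjoint_sym disjoint_setUr disjoint_sym dDSv disjoint_sym.
  apply/pred0P => z /=; apply/negP => /andP[/(subsetP subM)].
  by rewrite in_setC in_setU => /norP[_ /negPf->].
have [sLM|/subsetPn[l lL lM]] := boolP (L \subset M); last first.
  apply: (threat l (D :|: M)) => //.
  by rewrite inE (disjointFr dXD) ?LX.
have leMa : #|M| <= a by rewrite cardM geq_minl.
(* The bounds [a <= #|L| <= #|M| <= a] leave no spare vertex: the whole move lies in [X], and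
   [Y :\ v] remains unplayed. *)
have eLM : L = M by apply/eqP; rewrite eqEcard sLM (leq_trans leMa).
apply: (IH (X :\: M) (Y :\ v)) win' => //.
- by move: leYn; rewrite (cardY1 v).
- have := cardsID M X; have := subset_leq_card (subsetIr X M).
  by move: defXY leMa; rewrite (cardY1 v vY) mulnS; clear; lia.
- exact: disjointW (subsetDl _ _) (subsetDl _ _) dXY.
- rewrite disjoint_setUr (disjointW (subsetDl _ _) (subxx _) dXD) /=.
  by rewrite -setI_eq0 setIC setIDA setDIl setDv set0I.
- apply/subsetP => y /setD1P[yv yY]; have := subsetP YU y yY.
  rewrite !inE (negPf yv) orbF => /norP[/negPf-> /negPf->]; rewrite orbF /= -eLM.
  by apply/negP => /LX yX; rewrite (disjointFr dXY yX) in yY.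
move=> x y /setDP[xX _] /(nbX x y xX); rewrite !inE.
by case: (y == v) => //=; rewrite ?orbT // orbF.
Qed.

(** * Comparison of the game threshold with the star partition width *)

Lemma Sgame_star_partition a : acyclic G -> 0 < a ->
  dominator_wins_Sgame G a 1 -> star_partitionable a [set: G].
Proof.
move=> acycG a_gt0 win.
have [//|[X [Y [_ dXY nbX defXY]]]] := star_partition_or_deficient [set: G] acycG a_gt0.
case: (deficient_staller_wins acycG a_gt0 defXY dXY _ _ _ _ win).
- by rewrite -setI_eq0 setI0.
- by rewrite -setI_eq0 setI0.
- by rewrite /unplayed setU0 setC0 subsetT.
by move=> x y xX xy; rewrite setU0 (nbX x).
Qed.

End Graph.

Theorem theorem25 :
  (forall G : sgraph, 1 < #|G| -> no_isolated G ->
     enat_le (Sgame_threshold G 1) (star_partition_width G)) /\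
  (forall T : sgraph, 1 < #|T| -> tree T ->
     Sgame_threshold T 1 = star_partition_width T).
Proof.
split=> [G _ _|T _ [_ acycT]].
  apply: least_le => k [k_gt0 /star_partitionE partk]; split=> //.
  exact: star_partition_wins.
apply: eq_least => k; split=> [][k_gt0 h]; split=> //.
  exact/star_partitionE/Sgame_star_partition.
by apply: star_partition_wins; apply/star_partitionE.
Qed.
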